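(* Let $n\ge 2$ and $1\le k\le n-1$ be integers, and let $F(W)=\frac{\sigma_n(W)}{\sigma_{n-k}(W)}$. For every $\tilde\delta$ with $1\ge\tilde\delta>0$ there exists a positive constant $\epsilon_0$, depending only on $n,k,\tilde\delta$, such that the following holds. Let $W=\mathrm{diag}(\lambda_1,\dots,\lambda_n)\in\Gamma_n$ be a diagonal matrix with $\lambda_1\ge\lambda_2\ge\cdots\ge\lambda_n>0$. Then for every real symmetric $n\times n$ matrix $\xi=(\xi_{\alpha\beta})$, with all derivatives of $F$ evaluated at $W$, $$-\sum_{\alpha,\beta,\gamma,\eta=1}^n F^{\alpha\beta,\gamma\eta}\xi_{\alpha\beta}\xi_{\gamma\eta}\ \ge\ (1+\epsilon_0)F^{11}\frac{\xi_{11}^2}{\lambda_1}+(1-\tilde\delta)\sum_{\alpha=2}^n F^{\alpha\alpha}\frac{\xi_{\alpha\alpha}^2}{\lambda_\alpha}-\frac{\left(\sum_{\alpha=1}^nF^{\alpha\alpha}\xi_{\alpha\alpha}\right)^2}{F}+\sum_{\substack{\alpha,\gamma\ge2\\ \alpha\ne\gamma}}F^{\alpha\alpha}\frac{\xi_{\alpha\gamma}^2}{\lambda_\gamma}+\left(1+\frac{n-k}{n-1}\right)\sum_{\alpha=2}^nF^{\alpha\alpha}\frac{\xi_{\alpha1}^2}{\lambda_1}.$$ In particular, let $(M,g)$ be an $n$-dimensional Riemannian manifold with a smooth symmetric $(0,2)$ tensor $W$ such that the eigenvalues of the endomorphism field $W_g=g^{-1}\circ W$ lie in $\Gamma_n$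 at every point, and let $x\in M$. Use a local orthonormal frame near $x$ in which $W$ is diagonal at $x$ with diagonal entries $\lambda_1\ge\cdots\ge\lambda_n>0$. Then, for every $1\le i\le n$, at $x$, $$-\sum_{\alpha,\beta,\gamma,\eta=1}^n F^{\alpha\beta,\gamma\eta}w_{\alpha\beta,i}w_{\gamma\eta,i}\ \ge\ (1+\epsilon_0)F^{11}\frac{w_{11,i}^2}{\lambda_1}+(1-\tilde\delta)\sum_{\alpha=2}^nF^{\alpha\alpha}\frac{w_{\alpha\alpha,i}^2}{\lambda_\alpha}-\frac{F_i^2}{F},$$ where $w_{\alpha\beta,i}=\nabla_iw_{\alpha\beta}$ and $F_i=\nabla_i\big(F(W_g)\big)$.
   Context: For $\lambda\in\mathbb{R}^n$, $\sigma_m(\lambda)$ is the $m$-th elementary symmetric polynomial of $\lambda_1,\dots,\lambda_n$. For a symmetric $n\times n$ matrix $W$, $\sigma_m(W)$ denotes $\sigma_m$ of the eigenvalues of $W$. The cone $\Gamma_n=\{\lambda\in\mathbb{R}^n:\sigma_m(\lambda)>0 \text{ for all } 1\le m\le n\}$ is the set of vectors with all entries positive; $W\in\Gamma_n$ means that the eigenvalue vector of $W$ lies in $\Gamma_n$. For a smooth function $F(W)$ of $W=(w_{\alpha\beta})$, $F^{\alpha\beta}(W)=\frac{\partial F(W)}{\partial w_{\alpha\beta}}$ and $F^{\alpha\beta,\gamma\eta}(W)=\frac{\partial^2F(W)}{\partial w_{\alpha\beta}\partial w_{\gamma\eta}}$ (so that, for symmetric $\xi$, $\sum F^{\alpha\beta,\gamma\eta}\xi_{\alpha\beta}\xi_{\gamma\eta}=\frac{d^2}{dt^2}\big|_{t=0}F(W+t\xi)$).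 In the manifold setting, $\nabla$ is the Levi-Civita connection of $g$, $w_{\alpha\beta}$ are the components of $W$ in the local orthonormal frame, $\nabla_i w_{\alpha\beta}$ are the components of the covariant derivative $\nabla W$ in that frame, and $F(W_g)=\frac{\sigma_n(W_g)}{\sigma_{n-k}(W_g)}$ is defined through the eigenvalues of $W_g=g^{-1}\circ W:TM\to TM$; $F$ and its derivatives $F^{\alpha\beta}$, $F^{\alpha\beta,\gamma\eta}$ are evaluated at the component matrix of $W$ at $x$. *)

(* Defs.v *)
From HB Require Import structures.
From mathcomp Require Import all_boot all_order all_algebra.
From mathcomp Require Import all_classical all_reals all_analysis.
From mathcomp Require Import complex.
(* Not imported: the notations of mpoly clash with those of mathcomp-analysis. *)
From mathcomp Require mpoly.

Set Implicit Arguments.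
Unset Strict Implicit.
Unset Printing Implicit Defensive.

Import Order.TTheory GRing.Theory Num.Theory numFieldNormedType.Exports.

Local Open Scope classical_set_scope.
Local Open Scope ring_scope.

Definition idx1 (n : nat) (hn : (2 <= n)%N) : 'I_n := Ordinal (ltnW hn).

Definition sigma (S : comNzRingType) (n : nat) (lam : 'I_n -> S) (m : nat) : S :=
  mpoly.meval lam (mpoly.mesym n S m).

(* The eigenvalues are taken in R[i], with multiplicity and in an unspecified
   order, so that symmetric functions of them make sense on all of 'M_n and
   the entries of the matrix can be varied independently of each other. *)
Definition eigenvalues (R : realType) (n : nat) (A : 'M[R]_n) : 'I_n -> R[i] :=
  fun i => nth 0
    (sval (closed_field_poly_normal (char_poly (map_mx (real_complex R) A)))) i.

Lemma char_poly_eigenvalues (R : realType) (n : nat) (A : 'M[R]_n) :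
  char_poly (map_mx (real_complex R) A)
  = \prod_(i < n) ('X - (eigenvalues A i)%:P).
Proof.
rewrite /eigenvalues.
case: closed_field_poly_normal => s /=.
rewrite (monicP (char_poly_monic _)) scale1r => ps.
have /eqP : size (char_poly (map_mx (real_complex R) A)) = n.+1.
  by rewrite size_char_poly.
rewrite ps size_prod_XsubC eqSS => /eqP ss.
by rewrite (big_nth 0) big_mkord ss.
Qed.

(* sigma of the complex eigenvalues is a coefficient of a real polynomial,
   hence real: Re only changes the type. *)
Definition sigma_mx (R : realType) (n : nat) (A : 'M[R]_n) (m : nat) : R :=
  complex.Re (sigma (eigenvalues A) m).

Definition Gamma (R : realType) (n : nat) : set ('I_n -> R) :=
  [set lam | forall m : nat, (1 <= m <= n)%N -> 0 < sigma lam m].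

Definition in_Gamma (R : realType) (n : nat) (A : 'M[R]_n) : Prop :=
  exists2 lam : 'I_n -> R,
    forall i, eigenvalues A i = real_complex R (lam i) & Gamma lam.

Definition sigma_quot (R : realType) (n k : nat) (A : 'M[R]_n) : R :=
  sigma_mx A n / sigma_mx A (n - k).

Definition mx_d (R : realType) (n : nat) (F : 'M[R]_n -> R) (a b : 'I_n) :
    'M[R]_n -> R :=
  fun A => 'D_(delta_mx a b) F A.

Definition mx_d2 (R : realType) (n : nat) (F : 'M[R]_n -> R)
    (a b c d : 'I_n) : 'M[R]_n -> R :=
  mx_d (mx_d F c d) a b.

Definition pderiv (R : realType) (n : nat) (i : 'I_n) (f : 'rV[R]_n -> R) :
    'rV[R]_n -> R :=
  fun y => 'D_(delta_mx 0 i) f y.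

(* C^oo on U, for U open: all iterated partial derivatives exist and are
   continuous at the points of U. *)
Definition smooth_on (R : realType) (n : nat) (U : set 'rV[R]_n)
    (f : 'rV[R]_n -> R) : Prop :=
  forall (s : seq 'I_n) (y : 'rV[R]_n), U y ->
    {for y, continuous (foldr (@pderiv R n) f s)} /\
    forall i : 'I_n, derivable (foldr (@pderiv R n) f s) y (delta_mx 0 i).

Record smoothManifold (R : realType) (n : nat) := SmoothManifold {
  mpoint :> topologicalType;
  mpoint_hausdorff : hausdorff_space mpoint;
  mpoint_second_countable : @second_countable mpoint;
  chart : Type;
  dom : chart -> set mpoint;
  phi : chart -> mpoint -> 'rV[R]_n;
  psi : chart -> 'rV[R]_n -> mpoint;
  dom_cover : forall p : mpoint, exists a, dom a p;
  open_dom : forall a, open (dom a);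
  open_phi : forall a, open (phi a @` dom a);
  phiK : forall a p, dom a p -> psi a (phi a p) = p;
  phi_continuous : forall a, {within dom a, continuous (phi a)};
  psi_continuous : forall a, {within phi a @` dom a, continuous (psi a)};
  smooth_transition : forall a b (j : 'I_n),
    smooth_on (phi a @` (dom a `&` dom b)) (fun y => phi b (psi a y) 0 j)
}.

Arguments chart {R n} M : rename.
Arguments dom {R n M} : rename.
Arguments phi {R n M} : rename.
Arguments psi {R n M} : rename.

(* A (0,2) tensor field is given by its components in every chart.  The
   jacobian of the library acts on row vectors: its (i, j) entry is the
   derivative of the j-th new coordinate along the i-th old one. *)
Record tensor02 (R : realType) (n : nat) (M : smoothManifold R n) := Tensor02 {
  tcomp :> chart M -> M -> 'M[R]_n;
  tcomp_smooth : forall a (i j : 'I_n),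
    smooth_on (phi a @` dom a) (fun y => tcomp a (psi a y) i j);
  tcomp_change : forall a b p, dom a p -> dom b p ->
    let J := jacobian (phi b \o psi a) (phi a p) in
    tcomp a p = J *m tcomp b p *m J^T
}.

Section RiemannianGeometry.
Variables (R : realType) (n : nat) (M : smoothManifold R n).
Implicit Types (a : chart M) (g T : tensor02 M) (f : M -> R) (p : M).

Definition symmetric_tensor T : Prop :=
  forall a p, dom a p -> (T a p)^T = T a p.

Definition riemannian_metric g : Prop :=
  symmetric_tensor g /\
  forall a p, dom a p ->
    forall v : 'rV[R]_n, v != 0 -> 0 < (v *m g a p *m v^T) 0 0.

Definition coord_d a (i : 'I_n) f p : R := pderiv i (f \o psi a) (phi a p).

(* Christoffel symbol of the Levi-Civita connection, l being the upper index *)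
Definition christoffel g a p (l i j : 'I_n) : R :=
  2^-1 * \sum_m invmx (g a p) l m *
    (coord_d a i (fun q => g a q j m) p + coord_d a j (fun q => g a q i m) p
     - coord_d a m (fun q => g a q i j) p).

(* m is the index of differentiation *)
Definition nabla g T a p (m i j : 'I_n) : R :=
  coord_d a m (fun q => T a q i j) p
  - \sum_l christoffel g a p l m i * T a p l j
  - \sum_l christoffel g a p l m j * T a p i l.

(* g^-1 o T as an endomorphism of the tangent spaces *)
Definition endo g T a p : 'M[R]_n := invmx (g a p) *m T a p.

(* Row i of E p holds the components, in the chart a, of the i-th vector field
   of the frame at p. *)
Definition orthonormal_frame g a (O : set M) (E : M -> 'M[R]_n) : Prop :=
  [/\ open O, O `<=` dom a,
      forall i j : 'I_n, smooth_on (phi a @` O) (fun y => E (psi a y) i j) &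
      forall p, O p -> E p *m g a p *m (E p)^T = 1%:M].

Definition frame_comp T a (E : M -> 'M[R]_n) p : 'M[R]_n :=
  E p *m T a p *m (E p)^T.

Definition frame_d a (E : M -> 'M[R]_n) (i : 'I_n) f p : R :=
  \sum_m E p i m * coord_d a m f p.

Definition frame_nabla g T a (E : M -> 'M[R]_n) p (i b c : 'I_n) : R :=
  \sum_m \sum_q \sum_r E p i m * E p b q * E p c r * nabla g T a p m q r.

End RiemannianGeometry.

(* Main.v *)
(* With T a random (n-k)-subset of the indices, drawn with probability
   proportional to the product of the lambda_i over T, put
   p_a = P(a notin T), r_ac = P(not (a in T and c in T)) and
   y_a = xi_aa / lambda_a.  The numerator and the denominator of F are affine
   in each matrix entry, which gives F^{aa} = F p_a / lambda_a and
     - sum F^{ab,cd} xi_ab xi_cd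
       = F (E[Y^2] - 2 (sum p_a y_a)^2 + sum r_ac xi_ac^2 / (lambda_a lambda_c))
   with Y = sum_{a notin T} y_a.  As r_ac >= p_a and r_aa = p_a, everything
   reduces to Var Y >= eps0 p_1 y_1^2 - delta sum_{j >= 2} p_j y_j^2.  Replacing
   some j in T by 1 changes Y by y_1 - y_j and does not decrease the
   probability of T, since lambda_1 is largest; summing
   y_1^2 <= 4 (Y(T) - M)^2 + 4 (Y(T') - M)^2 + 2 y_j^2, M = E[Y], over these
   pairs gives the bound with eps0 = delta / (4 n).
   For the tensor statement, similarity gives F(g^-1 W) = F(E W E^T), and
   differentiating E g E^T = 1 shows that the diagonal entries of the
   derivative of E W E^T are those of the covariant derivative of W, so that
   F_i = sum_a F^{aa} w_{aa,i}. *)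

Require Import Defs.
From mathcomp Require Import all_boot all_order all_algebra perm.
From mathcomp Require Import all_classical all_reals all_analysis.
From mathcomp Require Import complex fraction ring lra.
From mathcomp Require mpoly.
Import (canonicals) mpoly.
Import Order.TTheory GRing.Theory Num.Theory numFieldNormedType.Exports.
Local Open Scope classical_set_scope.
Local Open Scope ring_scope.
Set Implicit Arguments.
Unset Strict Implicit.
Unset Printing Implicit Defensive.

(** * Elementary symmetric functions of the eigenvalues as characteristic coefficients *)

Lemma sigmaE (S : comNzRingType) (n : nat) (lam : 'I_n -> S) (m : nat) :
  sigma lam m = \sum_(T : {set 'I_n} | #|T| == m) \prod_(i in T) lam i.
Proof.
rewrite /sigma /mpoly.mesym rmorph_sum /=; apply: eq_bigr => T _.
by rewrite rmorph_prod /=; apply: eq_bigr => i _; rewrite mpoly.mevalXU.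
Qed.

Lemma coef_prod_XsubC (S : idomainType) (n : nat) (lam : 'I_n -> S) (m : nat) :
  (m <= n)%N ->
  (\prod_(i < n) ('X - (lam i)%:P))`_(n - m) = (-1) ^+ m * sigma lam m.
Proof.
move=> mn; have := @mpoly.mroots_coeff S n [tuple lam i | i < n] (inord m).
rewrite inordK ?ltnS // big_tuple.
under eq_bigr do rewrite tnth_mktuple.
move=> ->; congr (_ * _).
by apply: mpoly.meval_eq => i; rewrite tnth_mktuple.
Qed.

(** Vieta's formulas apply over [R[i]], where the characteristic polynomial splits; its coefficients
    are real, so the real part in [sigma_mx] loses nothing. Eigenvalues in unspecified order thus
    give way to a polynomial in the entries, also off the symmetric matrices. *)
Lemma sigma_mxE (R : realType) (n : nat) (A : 'M[R]_n) (m : nat) :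
  (m <= n)%N -> sigma_mx A m = (-1) ^+ m * (char_poly A)`_(n - m).
Proof.
move=> mn; rewrite /sigma_mx.
suff -> : sigma (eigenvalues A) m =
    real_complex R ((-1) ^+ m * (char_poly A)`_(n - m)) by [].
rewrite rmorphM rmorphXn rmorphN1 -coef_map map_char_poly.
rewrite char_poly_eigenvalues coef_prod_XsubC // mulrA -exprD.
by rewrite addnn -signr_odd odd_double mul1r.
Qed.

Lemma sigma_mx_diag (R : realType) (n : nat) (lam : 'rV[R]_n) (m : nat) :
  (m <= n)%N -> sigma_mx (diag_mx lam) m =
    \sum_(T : {set 'I_n} | #|T| == m) \prod_(i in T) lam 0 i.
Proof.
move=> mn; rewrite sigma_mxE // char_poly_trig ?diag_mx_is_trig //.
under eq_bigr do rewrite mxE eqxx mulr1n.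
rewrite (coef_prod_XsubC (fun i => lam 0 i)) // mulrA -exprD.
by rewrite addnn -signr_odd odd_double mul1r sigmaE.
Qed.

(** * Characteristic polynomial of a diagonal matrix with two perturbed entries *)

(** Sylvester's identity: one block matrix factors in two ways into block triangular matrices, and
    the determinants of the factors are compared. *)
Lemma det_1_mulmx_comm (S : comNzRingType) (p q : nat) (A : 'M[S]_(p, q))
    (B : 'M[S]_(q, p)) :
  \det (1%:M + A *m B) = \det (1%:M + B *m A).
Proof.
have H1 : block_mx 1%:M (- A) B 1%:M
    = block_mx 1%:M 0 B 1%:M *m block_mx 1%:M (- A) 0 (1%:M + B *m A).
  rewrite mulmx_block !(mul1mx, mulmx1, mul0mx, mulmx0, addr0, mulmxN).
  by rewrite addrCA addNr addr0.
have H2 : block_mx 1%:M (- A) B 1%:M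
    = block_mx (1%:M + A *m B) (- A) 0 1%:M *m block_mx 1%:M 0 B 1%:M.
  by rewrite mulmx_block !(mul1mx, mulmx1, mul0mx, mulmx0, addr0, add0r, mulNmx)
    addrK.
have := congr1 determinant H1; rewrite H2 !det_mulmx !det_ublock !det_lblock.
by rewrite !det1 !(mul1r, mulr1).
Qed.

Lemma det_block11 (S : comNzRingType) (x y z w : 'M[S]_1) :
  \det (block_mx x y z w) = x 0 0 * w 0 0 - y 0 0 * z 0 0.
Proof.
rewrite (expand_det_row _ (lshift 1 0)) big_split_ord /= !big_ord1.
rewrite block_mxEul block_mxEur /cofactor /= !det_mx11 !mxE /=.
have -> : @lift (1 + 1) (lshift 1 0) (0 : 'I_1) = rshift 1 0 by apply: val_inj.
have -> : @lift (1 + 1) (rshift 1 0) (0 : 'I_1) = lshift 1 0 by apply: val_inj.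
by rewrite (unsplitK (inr 0)) row_mxEr row_mxEl /= expr1 mul1r mulN1r mulrN.
Qed.

(** Once [diag_mx d] is factored out, the perturbation is [U *m V] of rank at most two; exchanging
    the two factors leaves a 2 by 2 determinant. *)
Lemma det_diag_delta2 (K : fieldType) (n : nat) (d : 'rV[K]_n)
    (a b c e : 'I_n) (s t : K) : (forall i, d 0 i != 0) ->
  \det (diag_mx d + s *: delta_mx a b + t *: delta_mx c e) =
  (\prod_i d 0 i) * ((1 + (a == b)%:R * (s / d 0 a)) * (1 + (c == e)%:R * (t / d 0 c))
    - (a == e)%:R * (b == c)%:R * (s / d 0 a) * (t / d 0 c)).
Proof.
move=> d0.
pose U : 'M[K]_(n, 1 + 1) :=
  row_mx ((s / d 0 a) *: delta_mx a 0) ((t / d 0 c) *: delta_mx c 0).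
pose V : 'M[K]_(1 + 1, n) := col_mx (delta_mx 0 b) (delta_mx 0 e).
have -> : diag_mx d + s *: delta_mx a b + t *: delta_mx c e =
    diag_mx d *m (1%:M + U *m V).
  rewrite mulmxDr mulmx1 mul_row_col mulmxDr -addrA -!scalemxAl !mul_delta_mx.
  rewrite -!scalemxAr; congr (_ + (_ + _)); apply/matrixP => i j.
    rewrite mul_diag_mx !mxE; case: eqVneq => [->|_] /=; last by rewrite !mulr0.
    by rewrite [in RHS]mulrA divfK.
  rewrite mul_diag_mx !mxE; case: eqVneq => [->|_] /=; last by rewrite !mulr0.
  by rewrite [in RHS]mulrA divfK.
rewrite det_mulmx det_diag det_1_mulmx_comm; congr (_ * _).
rewrite mul_col_row scalar_mx_block add_block_mx det_block11.
rewrite -!scalemxAr !mul_delta_mx_cond.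
rewrite !(eq_sym b, eq_sym e); case: (a == b); case: (c == e); case: (c == b);
  case: (a == e); rewrite !mxE /=; ring.
Qed.

(** Reduces arbitrary entries to diagonal perturbations, whose characteristic polynomials are
    explicit products. The identity is checked in the fraction field of the polynomial ring, where
    every ['X - (d 0 i)%:P] is invertible and [det_diag_delta2] applies. *)
Lemma char_poly_diag_delta2 (S : idomainType) (n : nat) (d : 'rV[S]_n)
    (a b c e : 'I_n) (s t : S) :
  let ch x y := char_poly (diag_mx d + x *: delta_mx a a + y *: delta_mx c c) in
  char_poly (diag_mx d + s *: delta_mx a b + t *: delta_mx c e) =
  ch 0 0 + (a == b)%:R * (ch s 0 - ch 0 0) + (c == e)%:R * (ch 0 t - ch 0 0)
  + ((a == b)%:R * (c == e)%:R - (a == e)%:R * (b == c)%:R)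
    * (ch s t - ch s 0 - ch 0 t + ch 0 0).
Proof.
move=> ch; pose D : 'rV[{fraction {poly S}}]_n := \row_i tofrac ('X - (d 0 i)%:P).
have D0 i : D 0 i != 0 by rewrite mxE tofrac_eq0 polyXsubC_eq0.
have chE i j k l (x y : S) :
    tofrac (char_poly (diag_mx d + x *: delta_mx i j + y *: delta_mx k l)) =
    \det (diag_mx D + tofrac (- x%:P) *: delta_mx i j + tofrac (- y%:P) *: delta_mx k l).
  rewrite /char_poly -det_map_mx; congr (\det _); apply/matrixP => u v.
  rewrite !mxE; case: (u == v); case: (_ && _); case: (_ && _);
    rewrite ?(mulr1n, mulr0n, mulr1, mulr0, addr0, polyC0, subr0, sub0r, rmorph0) //=;
    rewrite ?(polyCD, rmorphD, rmorphN, polyCN) /=; ring.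
pose q (x : S) i : {fraction {poly S}} := tofrac (- x%:P) / D 0 i.
have q0 i : q 0 i = 0 by rewrite /q polyC0 oppr0 tofrac0 mul0r.
have detE i j k l x y :
    tofrac (char_poly (diag_mx d + x *: delta_mx i j + y *: delta_mx k l)) =
    (\prod_i D 0 i) * ((1 + (i == j)%:R * q x i) * (1 + (k == l)%:R * q y k)
      - (i == l)%:R * (j == k)%:R * q x i * q y k).
  by rewrite chE det_diag_delta2.
have chcE x y : tofrac (ch x y) =
    (\prod_i D 0 i) * ((1 + q x a) * (1 + q y c) - (a == c)%:R * q x a * q y c).
  by rewrite /ch detE !eqxx !mul1r -natrM mulnb andbb.
apply/eqP; rewrite -tofrac_eq; apply/eqP.
rewrite detE !(tofracD, tofracN, tofracM) !rmorph_nat !chcE !q0.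
move: (q s a) (q t c) (\prod_i _) => x y z.
(* For [a = c] both shifts hit the same diagonal entry, on which [ch] depends affinely, so its mixed
   second difference vanishes. *)
have [<-|ac] := eqVneq a c.
  rewrite (eq_sym b); move: (a == b)%:R (a == e)%:R => i j.
  by rewrite mulr1n; ring.
move: (a == b)%:R (c == e)%:R (a == e)%:R (b == c)%:R => i j k l.
by rewrite mulr0n; ring.
Qed.

Lemma prod_add_delta (K : fieldType) (n : nat) (d : 'rV[K]_n) (a : 'I_n)
    (s : K) (T : {set 'I_n}) : d 0 a != 0 ->
  \prod_(i in T) (d + s *: delta_mx 0 a) 0 i =
  (\prod_(i in T) d 0 i) * (1 + (a \in T)%:R * (s / d 0 a)).
Proof.
move=> da; have [aT|aT] := boolP (a \in T); last first.
  rewrite mul0r addr0 mulr1; apply: eq_bigr => i iT.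
  rewrite !mxE eqxx /=; case: eqP => [ia|_]; last by rewrite mulr0 addr0.
  by rewrite -ia iT in aT.
rewrite !(bigD1 a aT) /=.
rewrite (eq_bigr (fun i => d 0 i)) => [|i /andP[_ ia]].
  by rewrite !mxE !eqxx mulr1; field.
by rewrite !mxE eqxx (negPf ia) mulr0 addr0.
Qed.

(** One coefficient of the preceding identity, expanded over subsets: the result is affine in [s]
    and in [t] separately, and its mixed term only sees the sets containing both [a] and [c]. *)
Lemma sigma_mx_diag_delta2 (R : realType) (n : nat) (d : 'rV[R]_n)
    (a b c e : 'I_n) (s t : R) (m : nat) :
  (m <= n)%N -> (forall i, d 0 i != 0) ->
  sigma_mx (diag_mx d + s *: delta_mx a b + t *: delta_mx c e) m =
  \sum_(T : {set 'I_n} | #|T| == m) (\prod_(i in T) d 0 i) *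
    (1 + (a == b)%:R * (a \in T)%:R * (s / d 0 a)
       + (c == e)%:R * (c \in T)%:R * (t / d 0 c)
       + ((a == b)%:R * (c == e)%:R - (a == e)%:R * (b == c)%:R)
         * ((a \in T) && (c \in T))%:R * (s / d 0 a) * (t / d 0 c)).
Proof.
move=> mn d0.
pose sg x y := \sum_(T : {set 'I_n} | #|T| == m)
  \prod_(i in T) (d + x *: delta_mx 0 a + y *: delta_mx 0 c) 0 i.
have sgE x y :
    sigma_mx (diag_mx d + x *: delta_mx a a + y *: delta_mx c c) m = sg x y.
  rewrite (_ : _ + _ = diag_mx (d + x *: delta_mx 0 a + y *: delta_mx 0 c)).
    by rewrite sigma_mx_diag.
  apply/matrixP => i j; rewrite !mxE /=.
  have [<-|ij] := eqVneq i j; first by rewrite !mulr1n !andbb.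
  rewrite !mulr0n; have [ia|ia] := eqVneq i a; have [ic|ic] := eqVneq i c;
    rewrite /= ?(mulr0, addr0) //.
  - by rewrite -ia -ic [j == i]eq_sym (negPf ij) !mulr0n !mulr0 !addr0.
  - by rewrite -ia [j == i]eq_sym (negPf ij) mulr0n mulr0 addr0.
  - by rewrite -ic [j == i]eq_sym (negPf ij) mulr0n mulr0 addr0.
have chE x y : (char_poly (diag_mx d + x *: delta_mx a a + y *: delta_mx c c))`_(n - m)
    = (-1) ^+ m * sg x y.
  by rewrite -sgE sigma_mxE // mulrA -exprD addnn -signr_odd odd_double mul1r.
pose k1 : R := (a == b)%:R; pose k2 : R := (c == e)%:R.
pose k3 : R := k1 * k2 - (a == e)%:R * (b == c)%:R.
rewrite sigma_mxE // char_poly_diag_delta2.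
have natC (i : bool) : i%:R = (i%:R)%:P :> {poly R} by rewrite rmorph_nat.
rewrite !natC -!polyCM -polyCB -/k1 -/k2 -/k3.
move: (chE 0 0) (chE s 0) (chE 0 t) (chE s t).
move: (char_poly _) (char_poly _) (char_poly _) (char_poly _).
move=> p00 ps0 p0t pst E00 Es0 E0t Est.
rewrite !(coefD, coefCM, coefN) E00 Es0 E0t Est.
have sg00 : sg 0 0 = \sum_(T : {set 'I_n} | #|T| == m) \prod_(i in T) d 0 i.
  by rewrite /sg !scale0r !addr0.
have sgs0 x : sg x 0 = \sum_(T : {set 'I_n} | #|T| == m) (\prod_(i in T) d 0 i) *
    (1 + (a \in T)%:R * (x / d 0 a)).
  by rewrite /sg scale0r; apply: eq_bigr => T _; rewrite addr0 prod_add_delta.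
have sg0t y : sg 0 y = \sum_(T : {set 'I_n} | #|T| == m) (\prod_(i in T) d 0 i) *
    (1 + (c \in T)%:R * (y / d 0 c)).
  by rewrite /sg scale0r addr0; apply: eq_bigr => T _; rewrite prod_add_delta.
have k3sg : k3 * sg s t = k3 * \sum_(T : {set 'I_n} | #|T| == m)
    (\prod_(i in T) d 0 i) *
    ((1 + (a \in T)%:R * (s / d 0 a)) * (1 + (c \in T)%:R * (t / d 0 c))).
  (* The product formula for [sg s t] fails for [a = c], where the shifts add up in one factor, but
     then [k3 = 0]. This is why the identity carries the factor [k3]. *)
  have [ac|ac] := eqVneq a c.
    suff -> : k3 = 0 by rewrite !mul0r.
    by rewrite /k3 /k1 /k2 -ac [b == a]eq_sym; ring.
  congr (_ * _); apply: eq_bigr => T _.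
  have E : (d + s *: delta_mx 0 a) 0 c = d 0 c.
    by rewrite !mxE eqxx [c == a]eq_sym (negPf ac) mulr0 addr0.
  rewrite (@prod_add_delta _ _ _ c) ?E // (@prod_add_delta _ _ _ a) //.
  by rewrite -mulrA.
transitivity (sg 0 0 + k1 * (sg s 0 - sg 0 0) + k2 * (sg 0 t - sg 0 0)
    + (k3 * sg s t - k3 * (sg s 0 + sg 0 t - sg 0 0))).
  have alg (z p q r u x y w : R) : z ^+ 2 = 1 ->
      z * (z * p + x * (z * q - z * p) + y * (z * r - z * p)
        + w * (z * u - z * q - z * r + z * p)) =
      p + x * (q - p) + y * (r - p) + (w * u - w * (q + r - p)).
    by move=> z2; rewrite -[RHS]mul1r -z2; ring.
  exact/alg/sqrr_sign.
rewrite k3sg sg00 sgs0 sg0t -!(sumrB, big_split) /=.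
rewrite !mulr_sumr -!(sumrB, big_split) /=.
apply: eq_bigr => T _; rewrite -mulnb natrM -/k1 -/k2 -/k3.
move: (_ / _) (_ / _) (\prod_(_ in _) _) => x y z.
clear k3sg natC; move: (a \in T)%:R (c \in T)%:R k1 k2 k3 => i j p q r.
ring.
Qed.

(** * Directional derivatives of quotients of biaffine functions *)

(** Both sides are limits of the same difference quotient, so the equality holds whether or not the
    limit exists. *)
Lemma derive_line (R : realType) (V : normedModType R) (f : V -> R) (x v : V) :
  'D_v f x = 'D_1 (fun h : R => f (x + h *: v)) 0.
Proof.
rewrite /derive; set f1 := (fun h => _); set f2 := (fun h => _).
suff -> : f1 = f2 by []; apply: funext => h; rewrite /f1 /f2 /=.
by rewrite addr0 scale0r addr0 [h%:A]mulr1 [x + _]addrC.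
Qed.

Lemma is_derive_affine (R : realType) (A B x : R) :
  is_derive x 1 (fun t : R => A + B * t) B.
Proof.
have h := is_deriveD (is_derive_cst A x 1)
  (is_deriveM (is_derive_cst B x 1) (is_derive_id x 1)).
apply: is_derive_eq h _.
by rewrite scaler0 addr0 add0r [_ *: _]mulr1.
Qed.

Lemma is_derive_affine_quot (R : realType) (A B C D x : R) : C + D * x != 0 ->
  is_derive x 1 (fun t => (A + B * t) / (C + D * t))
    ((B * C - A * D) / (C + D * x) ^+ 2).
Proof.
move=> C0.
have h := is_deriveM (is_derive_affine A B x)
  (@is_deriveV _ (fun t => C + D * t) _ _ _ C0 (is_derive_affine C D x)).
apply: is_derive_eq h _.
rewrite /GRing.scale /=; field.
by [].
Qed.

Lemma near_affine_neq0 (R : realType) (C D : R) : C != 0 ->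
  \forall s \near (0 : R), C + D * s != 0.
Proof.
move=> C0.
have cont : {for 0, continuous (fun s : R => C + D * s)}.
  apply/differentiable_continuous/derivable1_diffP.
  by have [] := is_derive_affine C D 0.
have := @cvgr_neq0 _ _ _ (nbhs 0) _ (fun s : R => C + D * s) _ cont.
by rewrite mulr0 addr0; apply.
Qed.

(** On each line in direction [v] the function is a quotient of affine functions, so ['D_v F] is
    explicit along the line in direction [u] and can be differentiated once more. *)
Lemma derive2_biaffine_quot (R : realType) (V : normedModType R) (F : V -> R)
    (W u v : V) (n0 n1 n2 n3 d0 d1 d2 d3 : R) : d0 != 0 ->
  (forall s t, F (W + s *: u + t *: v) =
     (n0 + n1 * s + n2 * t + n3 * (s * t)) / (d0 + d1 * s + d2 * t + d3 * (s * t))) ->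
  'D_v F W = (n2 * d0 - n0 * d2) / d0 ^+ 2 /\
  'D_u ('D_v F) W =
    (n3 * d0 + n2 * d1 - n1 * d2 - n0 * d3) / d0 ^+ 2
    - 2 * d1 * (n2 * d0 - n0 * d2) / d0 ^+ 3.
Proof.
move=> d00 FE.
have inner s : d0 + d1 * s != 0 -> 'D_v F (W + s *: u) =
    ((n2 + n3 * s) * (d0 + d1 * s) - (n0 + n1 * s) * (d2 + d3 * s)) / (d0 + d1 * s) ^+ 2.
  move=> ds; rewrite derive_line.
  have -> : (fun h : R => F (W + s *: u + h *: v)) =
     (fun t => ((n0 + n1 * s) + (n2 + n3 * s) * t) / ((d0 + d1 * s) + (d2 + d3 * s) * t)).
    by apply: funext => t; rewrite FE; congr (_ / _); ring.
  rewrite (@derive_val _ _ _ _ _ _ _ (is_derive_affine_quot _ _ _)) ?mulr0 ?addr0 //.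
split.
  by have := inner 0; rewrite scale0r !mulr0 !addr0 => ->.
rewrite derive_line.
pose g (s : R) := ((n2 + n3 * s) * (d0 + d1 * s) - (n0 + n1 * s) * (d2 + d3 * s))
   / (d0 + d1 * s) ^+ 2.
(* The closed form [g] is known only where the denominator is nonzero; this is a neighbourhood of 0,
   which is all that the outer derivative sees. *)
have -> : 'D_1 (fun h : R => 'D_v F (W + h *: u)) 0 = 'D_1 g 0.
  by apply: near_eq_derive; near=> s; apply: inner; near: s; exact: near_affine_neq0.
have hd := is_derive_affine d0 d1 0.
have d00' : d0 + d1 * 0 != 0 by rewrite mulr0 addr0.
have d02 : ((d0 + d1 * 0) * (d0 + d1 * 0)) != 0 by rewrite mulf_neq0.
have h := is_deriveM
  (is_deriveB (is_deriveM (is_derive_affine n2 n3 0) hd)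
     (is_deriveM (is_derive_affine n0 n1 0) (is_derive_affine d2 d3 0)))
  (@is_deriveV _ (fun s => (d0 + d1 * s) * (d0 + d1 * s)) _ _ _ d02
     (is_deriveM hd hd)).
have [_] := h.
rewrite /GRing.scale /= => h2; rewrite [LHS]h2.
rewrite [X in X * (- _ * _) + _](_ : _ =
  (n2 + n3 * 0) * (d0 + d1 * 0) - (n0 + n1 * 0) * (d2 + d3 * 0)) //.
rewrite !mulr0 !addr0; field.
by [].
Unshelve. all: by end_near. Qed.

(** * Averages over weighted subsets of fixed size *)

(* Expectation of [f T] when the [m]-subset [T] is drawn with probability
   proportional to [\prod_(i in T) d 0 i]. *)
Definition avg (R : realType) (n m : nat) (d : 'rV[R]_n)
    (f : {set 'I_n} -> R) : R :=
  (\sum_(T : {set 'I_n} | #|T| == m) (\prod_(i in T) d 0 i) * f T) /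
  (\sum_(T : {set 'I_n} | #|T| == m) \prod_(i in T) d 0 i).

Lemma weight_sum_gt0 (R : realType) (n m : nat) (d : 'rV[R]_n) :
  (m <= n)%N -> (forall i, 0 < d 0 i) ->
  0 < \sum_(T : {set 'I_n} | #|T| == m) \prod_(i in T) d 0 i.
Proof.
move=> mn d0.
have wt0 (T : {set 'I_n}) : 0 < \prod_(i in T) d 0 i.
  by apply: prodr_gt0 => i _; exact: d0.
have [T Tm] : exists T : {set 'I_n}, #|T| == m.
  have : (0 < #|[set T : {set 'I_n} | #|T| == m]%SET|)%N.
    by rewrite card_draws card_ord bin_gt0.
  by case/card_gt0P => T; rewrite inE => Tm; exists T.
rewrite (bigD1 T) //=; apply: ltr_pwDl => //.
by apply: sumr_ge0 => U _; exact: ltW.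
Qed.

Section Avg.
Variables (R : realType) (n m : nat) (d : 'rV[R]_n).
Hypotheses (mn : (m <= n)%N) (d_gt0 : forall i, 0 < d 0 i).

Lemma eq_avg (f g : {set 'I_n} -> R) : (forall T : {set 'I_n}, #|T| = m -> f T = g T) ->
  avg m d f = avg m d g.
Proof. by move=> fg; congr (_ / _); apply: eq_bigr => T /eqP/fg ->. Qed.

Lemma avgD (f g : {set 'I_n} -> R) :
  avg m d (fun T => f T + g T) = avg m d f + avg m d g.
Proof.
by rewrite /avg -mulrDl -big_split /=; congr (_ / _); apply: eq_bigr => T _;
  rewrite mulrDr.
Qed.

Lemma avgZ (c : R) (f : {set 'I_n} -> R) :
  avg m d (fun T => c * f T) = c * avg m d f.
Proof.
by rewrite /avg mulrA mulr_sumr; congr (_ / _); apply: eq_bigr => T _;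
  rewrite mulrCA.
Qed.

Lemma avg_sum (I : finType) (P : pred I) (f : I -> {set 'I_n} -> R) :
  avg m d (fun T => \sum_(i | P i) f i T) = \sum_(i | P i) avg m d (f i).
Proof.
rewrite /avg -mulr_suml exchange_big /=; congr (_ / _).
by apply: eq_bigr => T _; rewrite mulr_sumr.
Qed.

Lemma avg_cst (c : R) : avg m d (fun=> c) = c.
Proof.
by rewrite /avg -mulr_suml mulrAC mulfV ?mul1r // gt_eqF // weight_sum_gt0.
Qed.

Lemma avg_le (f g : {set 'I_n} -> R) : (forall T : {set 'I_n}, #|T| = m -> f T <= g T) ->
  avg m d f <= avg m d g.
Proof.
move=> fg; rewrite /avg ler_wpM2r ?invr_ge0 ?(ltW (weight_sum_gt0 _ _)) //.
apply: ler_sum => T /eqP Tm; rewrite ler_wpM2l ?fg //.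
by apply: prodr_ge0 => i _; exact: ltW.
Qed.

Lemma avg_ge0 (f : {set 'I_n} -> R) : (forall T : {set 'I_n}, #|T| = m -> 0 <= f T) ->
  0 <= avg m d f.
Proof. by move=> f0; rewrite -(avg_cst 0); exact: avg_le. Qed.

End Avg.

(** * First and second derivatives of the quotient at a diagonal matrix *)

Section QuotientDerivatives.
Variables (R : realType) (n k : nat) (d : 'rV[R]_n).
Hypothesis (d_gt0 : forall i, 0 < d 0 i).
Let E := avg (n - k) d.
Let p a : R := E (fun T => (a \notin T)%:R).
Let F : 'M[R]_n -> R := sigma_quot k.
Let W := diag_mx d.

Lemma sigma_quot_diag_gt0 : 0 < F W.
Proof.
rewrite /F /sigma_quot !sigma_mx_diag ?leq_subr //.
by apply: divr_gt0; apply: weight_sum_gt0 => //; exact: leq_subr.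
Qed.

Lemma avg_mem (f : {set 'I_n} -> bool) :
  E (fun T => (f T)%:R) = 1 - E (fun T => (~~ f T)%:R).
Proof.
apply: (addIr (E (fun T => (~~ f T)%:R))); rewrite subrK -avgD.
rewrite -[RHS](avg_cst (leq_subr k n) d_gt0).
by apply: eq_avg => T _; case: (f T); rewrite ?addr0 ?add0r.
Qed.

(** In the expansion in two entries the denominator carries membership probabilities, which are all
    1 in the numerator, so the quotient rule produces the complementary probabilities. The Kronecker
    factors leave only the cases [a = b, c = e] and [a = e, b = c] for second derivatives. *)
Lemma mx_d_sigma_quot (a b c e : 'I_n) :
  mx_d F c e W = (c == e)%:R * (F W * p c / d 0 c) /\
  mx_d2 F a b c e W = F W / (d 0 a * d 0 c) *
    (((a == b)%:R * (c == e)%:R - (a == e)%:R * (b == c)%:R)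
       * E (fun T => (~~ ((a \in T) && (c \in T)))%:R)
     - (a == b)%:R * (c == e)%:R * (p a + p c - 2 * p a * p c)).
Proof.
have d0 i : d 0 i != 0 by rewrite gt_eqF.
pose D := \sum_(T : {set 'I_n} | #|T| == (n - k)%N) \prod_(i in T) d 0 i.
pose N := \prod_i d 0 i.
have D0 : D != 0 by rewrite gt_eqF // weight_sum_gt0 // leq_subr.
have EE f : D * E f =
    \sum_(T : {set 'I_n} | #|T| == (n - k)%N) (\prod_(i in T) d 0 i) * f T.
  by rewrite /E /avg mulrCA mulfV ?mulr1.
pose k3 : R := ((a == b)%:R * (c == e)%:R - (a == e)%:R * (b == c)%:R).
pose k1 : R := (a == b)%:R. pose k2 : R := (c == e)%:R.
have FE s t : F (W + s *: delta_mx a b + t *: delta_mx c e) =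
   (N + N * k1 / d 0 a * s + N * k2 / d 0 c * t + N * k3 / (d 0 a * d 0 c) * (s * t))
   / (D + D * k1 / d 0 a * E (fun T => (a \in T)%:R) * s
        + D * k2 / d 0 c * E (fun T => (c \in T)%:R) * t
        + D * k3 / (d 0 a * d 0 c) * E (fun T => ((a \in T) && (c \in T))%:R) * (s * t)).
  rewrite /F /sigma_quot !sigma_mx_diag_delta2 ?leq_subr //; congr (_ / _).
    (* The full set is the only subset of size [n], so the numerator is a single product. *)
    rewrite (big_pred1 [set: 'I_n]%SET) => [|T]; last first.
      rewrite /= [RHS]eqEcard finset.subsetT cardsT eqn_leq card_ord.
      by have := max_card T; rewrite card_ord => ->.
    rewrite (eq_bigl xpredT) => [|i]; last by rewrite inE.
    rewrite !inE /= -/N -/k1 -/k2 -/k3 !mulr1; field.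
    by rewrite !d0.
  rewrite [RHS](_ : _ = D + (k1 / d 0 a * s) * (D * E (fun T => (a \in T)%:R))
      + (k2 / d 0 c * t) * (D * E (fun T => (c \in T)%:R))
      + (k3 / (d 0 a * d 0 c) * (s * t))
        * (D * E (fun T => ((a \in T) && (c \in T))%:R))); last first.
    by field; rewrite !d0.
  rewrite !EE !mulr_sumr -!big_split /=; apply: eq_bigr => T _.
  rewrite invfM -/k1 -/k2 -/k3.
  move: (\prod_(i in T) _) (d 0 a)^-1 (d 0 c)^-1 => w x y.
  move: (a \in T)%:R (c \in T)%:R (_ && _)%:R => i j l.
  ring.
have [mx1 mx2] := derive2_biaffine_quot D0 FE.
have FW : F W = N / D.
  by have := FE 0 0; rewrite !scale0r !addr0 !mulr0 !addr0.
rewrite /mx_d2 /mx_d mx1 mx2 FW (avg_mem (fun T => a \in T)) (avg_mem (fun T => c \in T))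
  (avg_mem (fun T => (a \in T) && (c \in T))).
rewrite -/k3 -/k1 -/k2 -/(p a) -/(p c).
move: (p a) (p c) (E _) => x y z.
by split; field; rewrite !d0.
Qed.

End QuotientDerivatives.

(** * A variance bound for sums over the complement of a random subset *)

Section ComplementSumVariance.
Variables (R : realType) (n m : nat) (d : 'rV[R]_n) (o : 'I_n).
Hypotheses (m0 : (0 < m)%N) (mn : (m <= n)%N).
Hypotheses (d_gt0 : forall i, 0 < d 0 i) (d_max : forall i, d 0 i <= d 0 o).
Let E := avg m d.
Let p a : R := E (fun T => (a \notin T)%:R).

Let swap (j : 'I_n) (T : {set 'I_n}) : {set 'I_n} := (tperm o j @: T)%SET.

Let mem_swap j T i : (i \in swap j T) = (tperm o j i \in T).
Proof.
by rewrite /swap -[X in X \in _ @: _](tpermK o j) mem_imset //; exact: perm_inj.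
Qed.

(* Exchanging [j] for the largest weight [d 0 o] can only increase the
   probability of a set. *)
Lemma avg_swap_le (j : 'I_n) (h : {set 'I_n} -> R) : j != o ->
  (forall T, 0 <= h T) ->
  E (fun T => ((o \notin T) && (j \in T))%:R * h (swap j T)) <=
  E (fun T => ((o \in T) && (j \notin T))%:R * h T).
Proof.
move=> jo h0; rewrite /E /avg ler_wpM2r ?invr_ge0 ?(ltW (weight_sum_gt0 _ _)) //.
have swap_inj : injective (swap j) by apply: imset_inj; exact: perm_inj.
rewrite [leRHS](reindex_inj swap_inj) /=.
rewrite [leRHS](eq_bigl (fun T : {set 'I_n} => #|T| == m)); last first.
  by move=> T; rewrite /swap card_imset //; exact: perm_inj.
apply: ler_sum => T _; rewrite !mem_swap tpermL tpermR [(j \in T) && _]andbC.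
have [/andP[oT jT]|_] := boolP (_ && _); last by rewrite !mul0r !mulr0.
rewrite !mul1r ler_wpM2r // /swap big_imset /=; last by move=> ? ? _ _; exact: perm_inj.
rewrite !(bigD1 j jT) /= tpermR ler_pM ?(ltW (d_gt0 _)) //.
  by apply: prodr_ge0 => i _; exact: ltW.
apply: ler_prod => i /andP[iT ij]; rewrite (ltW (d_gt0 _)) tpermD ?lexx 1?eq_sym //.
by apply: contraNneq oT => <-; exact: iT.
Qed.

Section Weights.
Variables (y : 'I_n -> R) (M : R).
Let Z (T : {set 'I_n}) := \sum_(i | i \notin T) y i.

Let Z_swap (j : 'I_n) (T : {set 'I_n}) : j != o -> o \notin T -> j \in T ->
  Z T - Z (swap j T) = y o - y j.
Proof.
move=> jo oT jT.
rewrite /Z [X in _ - X](reindex_inj (@perm_inj _ (tperm o j))) /=.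
rewrite [X in _ - X](eq_bigl (fun i => i \notin T)); last first.
  by move=> i; rewrite mem_swap tpermK.
rewrite !(bigD1 o oT) /= tpermL opprD addrACA.
rewrite [X in _ + X](_ : _ = 0) ?addr0 //; apply/eqP; rewrite subr_eq0; apply/eqP.
apply: eq_bigr => i /andP[iT io]; rewrite tpermD // 1?eq_sym //.
by apply: contraNneq iT => ->.
Qed.

(** With [a] and [b] the deviations from [M] at [T] and at the swapped set, [y o = y j + a - b],
    whose square is at most [4 a^2 + 4 b^2 + 2 (y j)^2]. The average is then transported by
    [avg_swap_le]. *)
Lemma swap_pair_bound (j : 'I_n) : j != o ->
  y o ^+ 2 * E (fun T => ((o \notin T) && (j \in T))%:R) <=
  4 * E (fun T => (Z T - M) ^+ 2) + 2 * (y j ^+ 2 * p j).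
Proof.
(* The term in [y j] is carried through the swap together with the deviation: it then lives on sets
   avoiding [j], which is where [p j] comes from. *)
move=> jo; pose h T := 4 * (Z T - M) ^+ 2 + 2 * y j ^+ 2.
have h0 T : 0 <= h T by rewrite /h addr_ge0 // mulr_ge0 // sqr_ge0.
have := avg_swap_le jo h0; set B := E _ => hB.
have H1 : y o ^+ 2 * E (fun T => ((o \notin T) && (j \in T))%:R) <=
    E (fun T => ((o \notin T) && (j \in T))%:R * (4 * (Z T - M) ^+ 2)) + B.
  rewrite /B /E -avgZ -avgD; apply: avg_le => // T _.
  have [/andP[oT jT]|_] := boolP (_ && _); last by rewrite !mul0r mulr0 addr0.
  rewrite !mul1r mulr1 /h; have := Z_swap jo oT jT.
  move: (Z _) (Z _) => v u uv.
  have -> : y o = y j + (u - M) - (v - M) by lra.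
  move: (u - M) (v - M) (y j) => a b c.
  have := sqr_ge0 (a + b); have := sqr_ge0 (c - a + b); nra.
(* The two events, [o] out and [j] in against [o] in and [j] out, are disjoint, so the variance is
   counted once and its coefficient stays 4. *)
apply: (le_trans H1); apply: (le_trans (lerD (lexx _) hB)).
rewrite /p /E -!avgZ -!avgD; apply: avg_le => // T _; rewrite /h.
have := sqr_ge0 (Z T - M); have := sqr_ge0 (y j).
by case: (o \in T); case: (j \in T); rewrite /= ?mulr1n ?mulr0n; nra.
Qed.

(** As [m > 0], a set missing [o] contains some [j] other than [o]. A union bound over these at most
    [n] indices reduces the claim to [swap_pair_bound]. *)
Lemma top_weight_bound :
  p o * y o ^+ 2 <=
  4 * n%:R * E (fun T => (Z T - M) ^+ 2) + 2 * (\sum_(j | j != o) p j * y j ^+ 2).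
Proof.
have V0 : 0 <= E (fun T => (Z T - M) ^+ 2).
  by apply: avg_ge0 => // T _; exact: sqr_ge0.
have H : p o <= \sum_(j | j != o) E (fun T => ((o \notin T) && (j \in T))%:R).
  rewrite /p /E -avg_sum; apply: avg_le => // T Tm.
  have [oT|oT] := boolP (o \in T); first by rewrite sumr_ge0.
  have /card_gt0P[j jT] : (0 < #|T|)%N by rewrite Tm.
  have jo : j != o by apply: contraNneq oT => <-.
  by rewrite (bigD1 j) //= jT lerDl sumr_ge0.
apply: (@le_trans _ _ (\sum_(j | j != o)
    (4 * E (fun T => (Z T - M) ^+ 2) + 2 * (y j ^+ 2 * p j)))).
  rewrite mulrC; apply: (le_trans (ler_wpM2l (sqr_ge0 _) H)).
  by rewrite mulr_sumr; apply: ler_sum => j jo; exact: swap_pair_bound.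
rewrite big_split /= mulr_sumr; apply: lerD; last first.
  by apply: ler_sum => j _; rewrite [y j ^+ 2 * _]mulrC.
rewrite sumr_const -[leLHS]mulr_natr -mulrA [X in _ * X]mulrC mulrA ler_wpM2r //.
by rewrite ler_wpM2l // ler_nat -[leqRHS]card_ord max_card.
Qed.
End Weights.

Lemma avg_sqr_complement_sum (y : 'I_n -> R) :
  E (fun T => (\sum_(i | i \notin T) y i) ^+ 2) =
  \sum_a \sum_c E (fun T => ((a \notin T) && (c \notin T))%:R) * (y a * y c).
Proof.
under [RHS]eq_bigr do under eq_bigr do rewrite mulrC -avgZ.
under [RHS]eq_bigr do rewrite -avg_sum.
rewrite -avg_sum; apply: eq_avg => T _.
rewrite expr2 big_distrlr /= big_mkcond /=; apply: eq_bigr => a _.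
case: ifP => [aT|_]; last by rewrite big1 // => c _; rewrite mulr0.
by rewrite big_mkcond; apply: eq_bigr => c _; case: ifP; rewrite ?mulr1 ?mulr0.
Qed.

(** The right-hand side is the variance of the complement sum, whose mean is the last sum. Scaling
    [top_weight_bound] by [delta / (4 n)] gives [delta V + delta S / (2 n)], and this is at most
    [V + delta S] because [delta <= 1] and [2 n >= 1]. *)
Lemma complement_sum_variance (y : 'I_n -> R) (delta : R) : 0 < delta <= 1 ->
  delta / (4 * n%:R) * (p o * y o ^+ 2)
    - delta * (\sum_(j | j != o) p j * y j ^+ 2) <=
  \sum_a \sum_c E (fun T => ((a \notin T) && (c \notin T))%:R) * (y a * y c)
    - (\sum_a p a * y a) ^+ 2.
Proof.
move=> /andP[delta0 delta1].
pose Z (T : {set 'I_n}) := \sum_(i | i \notin T) y i.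
pose M := \sum_a p a * y a.
have EZ : E Z = M.
  rewrite /M /p; under eq_bigr do rewrite mulrC -avgZ.
  rewrite -avg_sum; apply: eq_avg => T _.
  rewrite /Z big_mkcond; apply: eq_bigr => i _.
  by case: ifP; rewrite ?mulr1 ?mulr0.
have -> : \sum_a \sum_c E (fun T => ((a \notin T) && (c \notin T))%:R) * (y a * y c)
    - M ^+ 2 = E (fun T => (Z T - M) ^+ 2).
  rewrite -avg_sqr_complement_sum.
  have -> : E (fun T => (Z T - M) ^+ 2) =
      E (fun T => Z T ^+ 2 + ((- 2 * M) * Z T + M ^+ 2)).
    by apply: eq_avg => T _; ring.
  have EM : E (fun=> M ^+ 2) = M ^+ 2 by exact: avg_cst.
  by rewrite /E !avgD avgZ -/E EZ EM; ring.
have V0 : 0 <= E (fun T => (Z T - M) ^+ 2).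
  by apply: avg_ge0 => // T _; exact: sqr_ge0.
have n0 : 1 <= n%:R :> R by rewrite ler1n (leq_trans m0 mn).
have S0 : 0 <= \sum_(j | j != o) p j * y j ^+ 2.
  apply: sumr_ge0 => j _; rewrite mulr_ge0 ?sqr_ge0 //.
  by apply: avg_ge0 => // T _; rewrite ler0n.
have := top_weight_bound y M.
rewrite -/Z; move: (E _) (p o * _) (\sum_(j | _) _) V0 S0 => V P S V0 S0 H.
have n1 : 0 < n%:R :> R by exact: lt_le_trans n0.
have H1 : delta / (4 * n%:R) * P <= delta * V + delta * S * ((2 * n%:R)^-1).
  have -> : delta * V + delta * S * ((2 * n%:R)^-1) =
      delta / (4 * n%:R) * (4 * n%:R * V + 2 * S) by field; rewrite gt_eqF.
  by rewrite ler_wpM2l // divr_ge0 ?(ltW delta0) // mulr_ge0 // ltW.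
have H2 : (2 * n%:R)^-1 <= 1 :> R by rewrite invf_le1; lra.
have H3 : delta * S * ((2 * n%:R)^-1) <= delta * S.
  by rewrite ler_piMr // mulr_ge0 // ltW.
have H4 : delta * V <= V by rewrite ler_piMl.
by lra.
Qed.
End ComplementSumVariance.

(** * The Hessian form and the matrix inequality *)

Lemma sum_delta (R : realType) (n : nat) (i : 'I_n) (f : 'I_n -> R) :
  \sum_j (i == j)%:R * f j = f i.
Proof.
rewrite (bigD1 i) //= eqxx mul1r big1 ?addr0 // => j ji.
by rewrite eq_sym (negPf ji) mul0r.
Qed.

(** Isolates the blocks of the target inequality. Row and column [o] coincide by symmetry; the
    resulting factor 2 later dominates the coefficient of the [xi a one] terms. *)
Lemma sum_symmetric_split (R : realType) (n : nat) (o : 'I_n)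
    (G : 'I_n -> 'I_n -> R) : (forall a c, G a c = G c a) ->
  \sum_a \sum_c G a c = \sum_a G a a
    + (\sum_(a | a != o) \sum_(c | (c != o) && (a != c)) G a c
       + 2 * \sum_(a | a != o) G a o).
Proof.
move=> Gsym.
rewrite (bigD1 o) //= (bigD1 o (P := xpredT)) //= [in RHS](bigD1 o) //=.
have -> : \sum_(a | a != o) \sum_c G a c = \sum_(a | a != o) G a a +
    (\sum_(a | a != o) \sum_(c | (c != o) && (a != c)) G a c + \sum_(a | a != o) G a o).
  rewrite -!big_split /=; apply: eq_bigr => a ao.
  rewrite (bigD1 o) //= (bigD1 a) //= addrC -addrA; congr (_ + (_ + _)).
  by apply: eq_bigl => c; rewrite [a == c]eq_sym.
have -> : \sum_(i | i != o) G o i = \sum_(a | a != o) G a o.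
  by apply: eq_bigr => a _.
ring.
Qed.

Section DiagonalHessian.
Variables (R : realType) (n k : nat) (d : 'rV[R]_n).
Hypothesis (d_gt0 : forall i, 0 < d 0 i).
Let E := avg (n - k) d.
Let p a : R := E (fun T => (a \notin T)%:R).
Let r a c : R := E (fun T => (~~ ((a \in T) && (c \in T)))%:R).
Let F : 'M[R]_n -> R := sigma_quot k.
Let W := diag_mx d.

Lemma mx_d_diag a : mx_d F a a W = F W * p a / d 0 a.
Proof. by have [-> _] := mx_d_sigma_quot k d_gt0 a a a a; rewrite eqxx mul1r. Qed.

(** Inclusion-exclusion, checked set by set. *)
Lemma avg_notin_both a c :
  E (fun T => ((a \notin T) && (c \notin T))%:R) = p a + p c - r a c.
Proof.
apply: (addIr (r a c)); rewrite subrK /r /p /E -!avgD; apply: eq_avg => T _.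
by case: (a \in T); case: (c \in T); rewrite /= ?addr0 ?add0r.
Qed.

Lemma hessian_sigma_quot (xi : 'M[R]_n) : xi^T = xi ->
  - (\sum_(a < n) \sum_(b < n) \sum_(c < n) \sum_(e < n)
       mx_d2 F a b c e W * xi a b * xi c e) =
  F W * (\sum_a \sum_c E (fun T => ((a \notin T) && (c \notin T))%:R)
                        * (xi a a / d 0 a * (xi c c / d 0 c))
         - 2 * (\sum_a p a * (xi a a / d 0 a)) ^+ 2
         + \sum_a \sum_c r a c * (xi a c ^+ 2 / (d 0 a * d 0 c))).
Proof.
move=> xiT.
have xiC a c : xi c a = xi a c by rewrite -{1}xiT mxE.
have d0 i : d 0 i != 0 by rewrite gt_eqF.
(* [X] collects the second derivatives with [a = b, c = e], and [Y] those with [a = e, b = c]; for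
   symmetric [xi] the latter meet squares of entries. *)
pose X a c := F W / (d 0 a * d 0 c) * (r a c - (p a + p c - 2 * p a * p c)).
pose Y a c := F W / (d 0 a * d 0 c) * r a c.
have inner a b : \sum_(c < n) \sum_(e < n) mx_d2 F a b c e W * xi a b * xi c e =
    (a == b)%:R * (\sum_c X a c * xi a b * xi c c) - Y a b * xi a b * xi b a.
  under eq_bigr => c _.
    under eq_bigr => e _.
      have [_ ->] := mx_d_sigma_quot k d_gt0 a b c e.
      rewrite -/W -/F -/E -/(p a) -/(p c) -/(r a c).
      rewrite (_ : _ * _ * _ = (c == e)%:R * ((a == b)%:R * X a c * xi a b * xi c e)
         - (a == e)%:R * ((b == c)%:R * Y a c * xi a b * xi c e)); last first.
        by rewrite /X /Y; move: (_ / _) => q; ring.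
      over.
    rewrite big_split /= sumrN !sum_delta.
    over.
  rewrite big_split /= sumrN mulr_sumr; congr (_ - _).
    by apply: eq_bigr => c _; ring.
  rewrite (eq_bigr (fun c => (b == c)%:R * (Y a c * xi a b * xi c a))) ?sum_delta //.
  by move=> c _; ring.
under eq_bigr => a _.
  under eq_bigr => b _ do rewrite inner xiC.
  rewrite big_split /= sumrN sum_delta.
  over.
rewrite big_split /= sumrN opprB addrC mulrDr; congr (_ + _); last first.
  rewrite mulr_sumr; apply: eq_bigr => a _; rewrite mulr_sumr; apply: eq_bigr => c _.
  by rewrite /Y xiC; field; rewrite !d0.
rewrite expr2 big_distrlr /= mulr_sumr -sumrB mulr_sumr -sumrN.
apply: eq_bigr => a _; rewrite mulr_sumr -sumrB mulr_sumr -sumrN.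
apply: eq_bigr => c _; rewrite avg_notin_both /X; field.
by rewrite !d0.
Qed.
End DiagonalHessian.

Lemma diag_hessian_ineq (R : realType) (n k : nat) (hn : (2 <= n)%N)
    (hk : (1 <= k <= n - 1)%N) (delta : R) (hdelta : 0 < delta <= 1)
    (d : 'rV[R]_n) (xi : 'M[R]_n) :
  let one := idx1 hn in
  let F : 'M[R]_n -> R := sigma_quot k in
  let W := diag_mx d in
  (forall i : 'I_n, d 0 i <= d 0 one) -> (forall i : 'I_n, 0 < d 0 i) ->
  xi^T = xi ->
  - (\sum_(a < n) \sum_(b < n) \sum_(c < n) \sum_(e < n)
            mx_d2 F a b c e W * xi a b * xi c e)
       >= (1 + delta / (4 * n%:R)) * mx_d F one one W * (xi one one ^+ 2 / d 0 one)
          + (1 - delta) * (\sum_(a < n | a != one)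
              mx_d F a a W * (xi a a ^+ 2 / d 0 a))
          - (\sum_(a < n) mx_d F a a W * xi a a) ^+ 2 / F W
          + \sum_(a < n | a != one) \sum_(c < n | (c != one) && (a != c))
              mx_d F a a W * (xi a c ^+ 2 / d 0 c)
          + (1 + (n%:R - k%:R) / (n%:R - 1)) * (\sum_(a < n | a != one)
              mx_d F a a W * (xi a one ^+ 2 / d 0 one)).
Proof.
move=> one F W d_max d_gt0 xiT; case/andP: hk => k1 kn.
have n1 : (1 <= n)%N := ltnW hn.
have kltn : (k < n)%N by apply: leq_ltn_trans kn _; rewrite subn1 ltn_predL.
have m0 : (0 < n - k)%N by rewrite subn_gt0.
have mn : (n - k <= n)%N by exact: leq_subr.
rewrite hessian_sigma_quot //.
have d0 i : d 0 i != 0 by rewrite gt_eqF.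
have xiC a c : xi c a = xi a c by rewrite -{1}xiT mxE.
have F0 : 0 < F W by exact: sigma_quot_diag_gt0.
pose E := avg (n - k) d.
pose p a : R := E (fun T => (a \notin T)%:R).
pose r a c : R := E (fun T => (~~ ((a \in T) && (c \in T)))%:R).
pose y a := xi a a / d 0 a.
pose G a c := r a c * (xi a c ^+ 2 / (d 0 a * d 0 c)).
have p0 a : 0 <= p a by apply: avg_ge0 => // T _; exact: ler0n.
(* If [a] is outside [T], then [a] and [c] are not both inside. This comparison alone handles all
   off-diagonal entries. *)
have rp a c : p a <= r a c.
  apply: avg_le => // T _.
  by case: (a \in T); case: (c \in T); rewrite //= ler01.
have dd0 a c : 0 <= xi a c ^+ 2 / (d 0 a * d 0 c).
  by rewrite divr_ge0 ?sqr_ge0 // mulr_ge0 // ltW.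
have Gsym a c : G a c = G c a.
  rewrite /G xiC [d 0 a * _]mulrC; congr (_ * _).
  by apply: eq_avg => T _; rewrite andbC.
have Gdiag a : G a a = p a * y a ^+ 2.
  rewrite /G /y /r; congr (_ * _); last by field.
  by apply: eq_avg => T _; rewrite andbb.
have V := complement_sum_variance m0 mn d_gt0 d_max y hdelta.
rewrite -/E in V *.
rewrite (sum_symmetric_split one Gsym) (eq_bigr _ (fun a _ => Gdiag a)).
have md a : mx_d F a a W = F W * p a / d 0 a by exact: mx_d_diag.
have sumsq (Q : pred 'I_n) : \sum_(a | Q a) mx_d F a a W * (xi a a ^+ 2 / d 0 a) =
    F W * \sum_(a | Q a) p a * y a ^+ 2.
  rewrite mulr_sumr; apply: eq_bigr => a _; rewrite md /y; field.
  exact: d0.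
have -> : (1 + delta / (4 * n%:R)) * mx_d F one one W * (xi one one ^+ 2 / d 0 one) =
    F W * ((1 + delta / (4 * n%:R)) * (p one * y one ^+ 2)).
  rewrite md /y; move: (1 + _) => q; field; exact: d0.
rewrite sumsq.
have -> : (\sum_a mx_d F a a W * xi a a) ^+ 2 / F W =
    F W * (\sum_a p a * y a) ^+ 2.
  have -> : \sum_a mx_d F a a W * xi a a = F W * \sum_a p a * y a.
    by rewrite mulr_sumr; apply: eq_bigr => a _; rewrite md /y; field; exact: d0.
  by field; rewrite gt_eqF.
have off : \sum_(a | a != one) \sum_(c | (c != one) && (a != c))
      mx_d F a a W * (xi a c ^+ 2 / d 0 c) <=
    F W * \sum_(a | a != one) \sum_(c | (c != one) && (a != c)) G a c.
  rewrite mulr_sumr; apply: ler_sum => a _; rewrite mulr_sumr; apply: ler_sum => c _.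
  have -> : mx_d F a a W * (xi a c ^+ 2 / d 0 c) =
      F W * (p a * (xi a c ^+ 2 / (d 0 a * d 0 c))).
    by rewrite md; field; rewrite !d0.
  by rewrite ler_pM2l // ler_wpM2r.
have col : (1 + (n%:R - k%:R) / (n%:R - 1)) * (\sum_(a | a != one)
      mx_d F a a W * (xi a one ^+ 2 / d 0 one)) <=
    F W * (2 * \sum_(a | a != one) G a one).
  have n1R : 0 < n%:R - 1 :> R by rewrite subr_gt0 ltr1n.
  have kR : 1 <= k%:R :> R by rewrite ler1n.
  have knR : k%:R <= n%:R :> R by rewrite ler_nat ltnW.
  (* Here [1 <= k] enters: it makes the fraction at most 1. *)
  have c2 : 1 + (n%:R - k%:R) / (n%:R - 1) <= 2 :> R.
    have : (n%:R - k%:R) / (n%:R - 1) <= 1 :> R by rewrite ler_pdivrMr //; lra.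
    by lra.
  have S0 : 0 <= \sum_(a | a != one) mx_d F a a W * (xi a one ^+ 2 / d 0 one).
    apply: sumr_ge0 => a _.
    have da i : 0 <= d 0 i by exact: ltW.
    have Fge0 : 0 <= F W by exact: ltW.
    rewrite md; apply: mulr_ge0; apply: divr_ge0; rewrite ?sqr_ge0 ?da //.
    exact: mulr_ge0.
  apply: (le_trans (ler_wpM2r S0 c2)); rewrite mulrCA ler_wpM2l //.
  rewrite mulr_sumr; apply: ler_sum => a _.
  have -> : mx_d F a a W * (xi a one ^+ 2 / d 0 one) =
      F W * (p a * (xi a one ^+ 2 / (d 0 a * d 0 one))).
    by rewrite md; field; rewrite !d0.
  by rewrite ler_pM2l // ler_wpM2r.
apply: le_trans (lerD (lerD (lexx _) off) col) _.
(* Of the two copies of [- S1 ^+ 2] in the Hessian, one is the squared gradient term of the claim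
   and the other completes [S2] to a variance. The diagonal of [r] supplies [P1 + Q], so the gap
   between the sides is [F W] times the slack in [V]. *)
rewrite [X in _ <= _ * (_ + (X + _))](bigD1 one) //=.
pose P1 := p one * y one ^+ 2.
pose Q := \sum_(a | a != one) p a * y a ^+ 2.
pose S1 := \sum_a p a * y a.
pose S2 := \sum_a \sum_c E (fun T => ((a \notin T) && (c \notin T))%:R) * (y a * y c).
pose G1 := \sum_(a | a != one) \sum_(c | (c != one) && (a != c)) G a c.
pose G2 := \sum_(a | a != one) G a one.
have {}V : delta / (4 * n%:R) * P1 - delta * Q <= S2 - S1 ^+ 2 := V.
change (F W * ((1 + delta / (4 * n%:R)) * P1) + (1 - delta) * (F W * Q)
  - F W * S1 ^+ 2 + F W * G1 + F W * (2 * G2) <=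
  F W * (S2 - 2 * S1 ^+ 2 + (P1 + Q + (G1 + 2 * G2)))).
move: P1 Q S1 S2 G1 G2 (delta / _) V => P1 Q S1 S2 G1 G2 eps V.
have := ler_wpM2l (ltW F0) V; rewrite -subr_ge0 => V1; rewrite -subr_ge0.
suff -> : F W * (S2 - 2 * S1 ^+ 2 + (P1 + Q + (G1 + 2 * G2))) -
    (F W * ((1 + eps) * P1) + (1 - delta) * (F W * Q) - F W * S1 ^+ 2 + F W * G1 +
     F W * (2 * G2)) =
    F W * (S2 - S1 ^+ 2) - F W * (eps * P1 - delta * Q) by [].
by ring.
Qed.

(** * Conjugation invariance, differentiability and the chain rule *)

Lemma char_poly_conj (S : comNzRingType) (n : nat) (P Q A : 'M[S]_n) :
  P *m Q = 1%:M -> char_poly (P *m A *m Q) = char_poly A.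
Proof.
move=> PQ; rewrite /char_poly /char_poly_mx.
have PQ' : map_mx polyC P *m map_mx polyC Q = 1%:M :> 'M[{poly S}]_n.
  by rewrite -map_mxM PQ map_mx1.
rewrite (_ : 'X%:M - _ =
    map_mx polyC P *m ('X%:M - map_mx polyC A) *m map_mx polyC Q).
  by rewrite !det_mulmx mulrAC -det_mulmx PQ' det1 mul1r.
rewrite mulmxBr mulmxBl !map_mxM; congr (_ - _).
by rewrite scalar_mxC -mulmxA PQ' mulmx1.
Qed.

Lemma sigma_quot_conj (R : realType) (n k : nat) (P Q A : 'M[R]_n) :
  P *m Q = 1%:M -> sigma_quot k (P *m A *m Q) = sigma_quot k A.
Proof.
move=> PQ; rewrite /sigma_quot !sigma_mxE ?leq_subr //.
by rewrite char_poly_conj.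
Qed.

Section CoefDifferentiable.
Context {R : realType} {V : normedModType R}.

(** Coefficientwise differentiability is stable under sums and products, hence passes through the
    Leibniz expansion of the determinant. *)
Let coef_diff (P : V -> {poly R}) (x : V) :=
  forall i, differentiable (fun y => (P y)`_i : R) x.

Let coef_diffC (p : {poly R}) x : coef_diff (fun=> p) x.
Proof. by move=> i; exact: differentiable_cst. Qed.

Let coef_diffD P Q x : coef_diff P x -> coef_diff Q x ->
  coef_diff (fun y => P y + Q y) x.
Proof.
move=> dP dQ i.
rewrite (_ : (fun _ => _) = (fun y => (P y)`_i : R) + (fun y => (Q y)`_i)).
  exact: differentiableD.
by apply: funext => y; rewrite coefD.
Qed.

Let coef_diffM P Q x : coef_diff P x -> coef_diff Q x ->
  coef_diff (fun y => P y * Q y) x.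
Proof.
move=> dP dQ i.
rewrite (_ : (fun _ => _) =
    \sum_(j < i.+1) ((fun y => (P y)`_j : R) * (fun y => (Q y)`_(i - j)))).
  by apply: differentiable_sum => j; exact: differentiableM.
by apply: funext => y; rewrite coefM fct_sumE.
Qed.

Let coef_diff_sum (I : Type) (r : seq I) (P : I -> V -> {poly R}) x :
  (forall i, coef_diff (P i) x) -> coef_diff (fun y => \sum_(i <- r) P i y) x.
Proof.
move=> dP; elim: r => [|a r IH].
  by under eq_fun do rewrite big_nil; exact: coef_diffC.
by under eq_fun do rewrite big_cons; exact: coef_diffD.
Qed.

Let coef_diff_prod (I : Type) (r : seq I) (P : I -> V -> {poly R}) x :
  (forall i, coef_diff (P i) x) -> coef_diff (fun y => \prod_(i <- r) P i y) x.
Proof.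
move=> dP; elim: r => [|a r IH].
  by under eq_fun do rewrite big_nil; exact: coef_diffC.
by under eq_fun do rewrite big_cons; exact: coef_diffM.
Qed.

Lemma differentiable_char_poly (n : nat) (A : V -> 'M[R]_n) (x : V) (m : nat) :
  (forall i j, differentiable (fun y => A y i j : R) x) ->
  differentiable (fun y => (char_poly (A y))`_m : R) x.
Proof.
move=> dA; move: m.
rewrite -/(coef_diff (fun y => char_poly (A y)) x) /char_poly /determinant.
apply: coef_diff_sum => s; apply: coef_diffM; first exact: coef_diffC.
apply: coef_diff_prod => i.
under eq_fun do rewrite !mxE.
apply: coef_diffD; first exact: coef_diffC.
move=> j; under eq_fun do rewrite coefN coefC.
case: (j == 0)%N => /=; last exact: differentiable_cst.
exact: differentiableN.
Qed.

End CoefDifferentiable.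

(** The chain rule needs full differentiability, which partial derivatives in the matrix entries
    would not give by themselves. *)
Lemma differentiable_sigma_quot (R : realType) (n k : nat) (A : 'M[R]_n) :
  sigma_mx A (n - k) != 0 -> differentiable (sigma_quot k : 'M[R]_n -> R) A.
Proof.
move=> A0.
have ds m : (m <= n)%N -> differentiable (fun B : 'M[R]_n => sigma_mx B m : R) A.
  move=> mn.
  rewrite (_ : (fun _ => _) = (fun B => (-1) ^+ m *: ((char_poly B)`_(n - m) : R))).
    apply: differentiableZ; apply: differentiable_char_poly => i j.
    exact: differentiable_coord.
  by apply: funext => B; rewrite sigma_mxE.
rewrite (_ : sigma_quot k = (fun B : 'M[R]_n => sigma_mx B n : R) *
    (fun B => (sigma_mx B (n - k))^-1)); last by apply: funext.
apply: differentiableM; first exact: ds.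
by apply: differentiableV => //; apply: ds; exact: leq_subr.
Qed.

(** Only a directional derivative of [B] is given. Restricting to the line makes the inner map a
    function of one real variable, for which derivability is differentiability; the differential of
    [f] is then expanded in matrix units. *)
Lemma is_derive_matrix_comp (R : realType) (V : normedModType R) (n : nat)
    (f : 'M[R]_n -> R) (B : V -> 'M[R]_n) (dB : 'M[R]_n) (x v : V) :
  differentiable f (B x) ->
  (forall i j, is_derive x v (fun y => B y i j : R) (dB i j)) ->
  'D_v (f \o B) x = \sum_a \sum_b dB a b * mx_d f a b (B x).
Proof.
move=> df dBE.
have dBv : derivable B x v by apply/derivable_mxP => i j; case: (dBE i j).
have DB : 'D_v B x = dB.
  by rewrite derive_mx //; apply/matrixP => i j; rewrite mxE; case: (dBE i j).
pose g (h : R) := B (h *: v + x).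
have dg1 : derivable g 0 1 := (derivable1P B x v).1 dBv.
have dg : differentiable g 0 by apply: (derivable1_diffP g 0).1.
have g0 : g 0 = B x by rewrite /g scale0r add0r.
have dfg : differentiable f (g 0) by rewrite g0.
have -> : 'D_v (f \o B) x = 'd f (B x) dB.
  rewrite derive_line.
  have -> : (fun h : R => (f \o B) (x + h *: v)) = f \o g.
    by apply: funext => h; rewrite /g /= addrC.
  rewrite deriveE; last exact: differentiable_comp.
  rewrite diff_comp //= g0; congr ('d f (B x) _).
  rewrite -deriveE // -DB /derive.
  set f1 := (fun h => _); set f2 := (fun h => _).
  suff -> : f1 = f2 by [].
  apply: funext => h; rewrite /f1 /f2 /g /=.
  by rewrite addr0 scale0r add0r [h%:A]mulr1.
rewrite {1}[dB]matrix_sum_delta linear_sum; apply: eq_bigr => a _.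
rewrite linear_sum; apply: eq_bigr => b _.
by rewrite linearZ /= /mx_d deriveE.
Qed.

Lemma is_derive_mulmx (R : realType) (V : normedModType R) (n : nat)
    (A B : V -> 'M[R]_n) (dA dB : 'M[R]_n) (x v : V) :
  (forall i j, is_derive x v (fun y => A y i j : R) (dA i j)) ->
  (forall i j, is_derive x v (fun y => B y i j : R) (dB i j)) ->
  forall i j, is_derive x v (fun y => (A y *m B y) i j : R)
                ((dA *m B x + A x *m dB) i j).
Proof.
move=> hA hB i j.
have h := is_derive_sum (fun k => is_deriveM (hA i k) (hB k j)).
rewrite (_ : (fun _ => _) =
    \sum_(k < n) ((fun y => A y i k : R) * (fun y => B y k j))); last first.
  by apply: funext => y; rewrite mxE fct_sumE.
apply: is_derive_eq h _.
rewrite big_split /= addrC !mxE; congr (_ + _); apply: eq_bigr => k _.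
by rewrite /GRing.scale /= mulrC.
Qed.

(** * Covariant derivatives in an orthonormal frame *)

(* [C] holds the Christoffel symbols: its row [q] and column [l] entry is
   [Gamma^l_(m q)], for a fixed index [m] of differentiation. *)
Lemma covariant_diag_entry (R : realType) (n : nat)
    (E g W dE dg dW C : 'M[R]_n) (lam : 'rV[R]_n) (a : 'I_n) :
  E *m g *m E^T = 1%:M -> W^T = W -> E *m W *m E^T = diag_mx lam ->
  g^T = g -> dE *m g *m E^T + E *m dg *m E^T + E *m g *m dE^T = 0 ->
  C *m g + (C *m g)^T = dg ->
  (dE *m W *m E^T + E *m dW *m E^T + E *m W *m dE^T) a a =
  (E *m (dW - C *m W - W *m C^T) *m E^T) a a.
Proof.
move=> EgE WT EWE gT dEgE Cg.
have gEE : g *m E^T *m E = 1%:M by apply: mulmx1C; rewrite mulmxA.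
(* Since [g *m E^T] inverts [E], the diagonalization reads [W *m E^T = g *m E^T *m diag_mx lam]: on
   the diagonal, [W] may be traded for [g] at the price of [lam 0 a]. *)
have moveE (A : 'M[R]_n) : (A *m W *m E^T) a a = (A *m g *m E^T) a a * lam 0 a.
  have -> : A *m W *m E^T = A *m g *m E^T *m diag_mx lam.
    by rewrite -EWE -!mulmxA [g *m _]mulmxA [g *m E^T *m _]mulmxA gEE mul1mx.
  by rewrite mul_mx_diag mxE.
have trE (S A : 'M[R]_n) : S^T = S -> (E *m S *m A^T) a a = (A *m S *m E^T) a a.
  move=> ST; have -> : E *m S *m A^T = (A *m S *m E^T)^T.
    by rewrite !trmx_mul trmxK ST mulmxA.
  by rewrite mxE.
have addE (A B : 'M[R]_n) : (A + B) a a = A a a + B a a by rewrite mxE.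
have oppE (A : 'M[R]_n) : (- A) a a = - A a a by rewrite mxE.
(* A matrix and its transpose agree on the diagonal, so differentiated orthonormality with metric
   compatibility says [2 u + 2 w = 0], where [u] comes from the moving frame and [w] from the
   connection. Multiplied by [lam 0 a], this cancels the two corrections. *)
have /(congr1 (fun A : 'M[R]_n => A a a)) := dEgE.
rewrite !addE (trE _ _ gT) -Cg [RHS]mxE mulmxDr mulmxDl addE mulmxA.
rewrite [E *m (C *m g)^T *m E^T](_ : _ = E *m g *m (E *m C)^T); last first.
  by rewrite !trmx_mul gT !mulmxA.
rewrite (trE _ _ gT) => K.
rewrite mulmxBr mulmxBl mulmxBr mulmxBl !addE !oppE (trE _ _ WT).
rewrite [E *m (W *m C^T) *m E^T](_ : _ = E *m W *m (E *m C)^T); last first.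
  by rewrite trmx_mul !mulmxA.
rewrite (trE _ _ WT) [E *m (C *m W)]mulmxA !moveE.
move: K; move: ((dE *m g *m E^T) a a) ((E *m C *m g *m E^T) a a) => u w K.
by have -> : w = - u by [lra]; ring.
Qed.

Section OrthonormalFrame.
Variables (R : realType) (n : nat) (M : smoothManifold R n) (g : tensor02 M).
Variables (ch : chart M) (O : set M) (E : M -> 'M[R]_n) (x : M).
Hypotheses (gR : riemannian_metric g) (onE : orthonormal_frame g ch O E) (Ox : O x).
Let y0 := phi ch x.
Let Odom p : O p -> dom ch p.
Proof. by case: onE => _ Odom _ _; exact: Odom. Qed.

(** [psi] is continuous only within the chart image; as that image is open, the preimage of [O] is
    still a neighbourhood. Identities valid on [O] can therefore be differentiated at [x]. *)
Lemma near_psi_frame : \forall y \near y0, O (psi ch y).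
Proof.
have y0dom : (phi ch @` dom ch) y0 by exists x => //; exact: Odom.
have /subspace_continuousP/(_ _ y0dom) := @psi_continuous _ _ M ch.
have psi0 : psi ch y0 = x by apply: phiK; exact: Odom.
rewrite /from_subspace psi0.
have Onbhs : nbhs x O by apply: open_nbhs_nbhs; split => //; case: onE.
move=> /(_ _ Onbhs) H.
have A : \forall y \near y0, (phi ch @` dom ch) y.
  by apply: open_nbhs_nbhs; split => //; exact: open_phi.
have {}H : \forall y \near y0, (phi ch @` dom ch) y -> O (psi ch y) := H.
by apply: filterS2 H A => y; apply.
Qed.

Let is_derive_comp (T : tensor02 M) (m i j : 'I_n) :
  is_derive y0 (delta_mx 0 m) (fun y => T ch (psi ch y) i j : R)
    (coord_d ch m (fun q => T ch q i j) x).
Proof.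
have y0dom : (phi ch @` dom ch) y0 by exists x => //; exact: Odom.
have [_ /(_ m) dT] := @tcomp_smooth _ _ _ T ch i j [::] y0 y0dom.
exact: derivableP.
Qed.

Let is_derive_frame (m i j : 'I_n) :
  is_derive y0 (delta_mx 0 m) (fun y => E (psi ch y) i j : R)
    (coord_d ch m (fun q => E q i j) x).
Proof.
have [_ _ sE _] := onE.
have y0O : (phi ch @` O) y0 by exists x.
have [_ /(_ m) dE] := sE i j [::] y0 y0O.
exact: derivableP.
Qed.

Lemma coord_d_sym (T : tensor02 M) (m i j : 'I_n) : symmetric_tensor T ->
  coord_d ch m (fun q => T ch q i j) x = coord_d ch m (fun q => T ch q j i) x.
Proof.
move=> Tsym; apply: near_eq_derive; near=> y.
have Oy : O (psi ch y) by near: y; exact: near_psi_frame.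
by rewrite /= -[in LHS](Tsym _ _ (Odom Oy)) mxE.
Unshelve. all: by end_near. Qed.

Let gx := g ch x.
Let Ex := E x.
Let dE m := \matrix_(i, j) coord_d ch m (fun q => E q i j) x : 'M[R]_n.
Let dT (T : tensor02 M) m :=
  \matrix_(i, j) coord_d ch m (fun q => T ch q i j) x : 'M[R]_n.
Let Chr m := \matrix_(q, l) christoffel g ch x l m q : 'M[R]_n.

Let frame_orth p : O p -> E p *m g ch p *m (E p)^T = 1%:M.
Proof. by case: onE => _ _ _; apply. Qed.

Let gsym : gx^T = gx.
Proof. by case: gR => gs _; apply: gs; exact: Odom. Qed.

Let gx_unit : gx \in unitmx.
Proof. by have := mulmx1C (frame_orth Ox); rewrite mulmxA => /mulmx1_unit[]. Qed.

(** Contracting with [g] cancels its inverse in the Christoffel symbols. Of the three derivatives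
    left, those along [q] and [r] form an antisymmetric part and drop out on adding the
    transpose. *)
Lemma metric_compat (m : 'I_n) : Chr m *m gx + (Chr m *m gx)^T = dT g m.
Proof.
have ChrE q r : (Chr m *m gx) q r = 2^-1 *
    (coord_d ch m (fun p => g ch p q r) x + coord_d ch q (fun p => g ch p m r) x
     - coord_d ch r (fun p => g ch p m q) x).
  rewrite mxE.
  pose t s := coord_d ch m (fun p => g ch p q s) x
    + coord_d ch q (fun p => g ch p m s) x - coord_d ch s (fun p => g ch p m q) x.
  have -> : \sum_l (Chr m) q l * gx l r =
      \sum_s 2^-1 * t s * (gx *m invmx gx) r s.
    under eq_bigr => l _.
      rewrite mxE /christoffel -/gx mulrAC mulr_sumr.
      over.
    rewrite exchange_big /=; apply: eq_bigr => s _; rewrite mxE mulr_sumr.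
    apply: eq_bigr => l _; rewrite -[in gx l r]gsym mxE /t; ring.
  rewrite mulmxV //.
  by under eq_bigr do rewrite mxE mulrC; rewrite sum_delta.
have [gs _] := gR.
apply/matrixP => q r; rewrite mxE [X in _ + X]mxE !ChrE mxE.
by rewrite (coord_d_sym m r q gs); lra.
Qed.

Section SymmetricTensor.
Variables (W : tensor02 M).
Hypothesis Wsym : symmetric_tensor W.
Let Wx := W ch x.

(** Orthonormality makes [E p *m g ch p] and [(E p)^T] mutually inverse, and conjugating [endo] by
    them gives [frame_comp]. *)
Lemma sigma_quot_endo (k : nat) p : O p ->
  sigma_quot k (endo g W ch p) = sigma_quot k (frame_comp W ch E p).
Proof.
move=> Op; have EgE := frame_orth Op.
have gu : g ch p \in unitmx.
  by have := mulmx1C EgE; rewrite mulmxA => /mulmx1_unit[].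
have <- := sigma_quot_conj k (endo g W ch p) EgE.
by rewrite /endo /frame_comp mulmxA mulmxK.
Qed.

Let N m := \matrix_(q, r) nabla g W ch x m q r : 'M[R]_n.

Let NE m : N m = dT W m - Chr m *m Wx - Wx *m (Chr m)^T.
Proof.
apply/matrixP => q r; rewrite !mxE /nabla; congr (_ - _ - _);
  apply: eq_bigr => l _; rewrite !mxE //; exact: mulrC.
Qed.

Lemma nabla_sym m q r : nabla g W ch x m q r = nabla g W ch x m r q.
Proof.
rewrite /nabla (coord_d_sym m q r Wsym) -!addrA; congr (_ + _).
rewrite addrC; congr (- _ - _); apply: eq_bigr => l _; congr (_ * _);
  by rewrite -[in LHS](Wsym (Odom Ox)) mxE.
Qed.

Lemma frame_nablaE i a b :
  frame_nabla g W ch E x i a b = \sum_m Ex i m * (Ex *m N m *m Ex^T) a b.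
Proof.
apply: eq_bigr => m _; rewrite mxE mulr_sumr exchange_big /=.
apply: eq_bigr => r _; rewrite !mxE mulr_suml mulr_sumr.
by apply: eq_bigr => q _; rewrite !mxE; ring.
Qed.

Lemma frame_nabla_sym i a b :
  frame_nabla g W ch E x i a b = frame_nabla g W ch E x i b a.
Proof.
rewrite /frame_nabla; apply: eq_bigr => m _; rewrite exchange_big /=.
by apply: eq_bigr => q _; apply: eq_bigr => r _; rewrite nabla_sym; ring.
Qed.

(** Serves twice: for [W], and for [g], whose frame matrix is constantly 1 near [y0]. *)
Let dframe (T : tensor02 M) (m i j : 'I_n) :
  is_derive y0 (delta_mx 0 m) (fun y => frame_comp T ch E (psi ch y) i j : R)
    ((dE m *m T ch x *m Ex^T + Ex *m dT T m *m Ex^T + Ex *m T ch x *m (dE m)^T) i j).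
Proof.
have psi0 : psi ch y0 = x by apply: phiK; exact: Odom.
have hE a b : is_derive y0 (delta_mx 0 m) (fun y => E (psi ch y) a b : R) (dE m a b).
  by rewrite mxE; exact: is_derive_frame.
have hT a b : is_derive y0 (delta_mx 0 m) (fun y => T ch (psi ch y) a b : R) (dT T m a b).
  by rewrite mxE; exact: is_derive_comp.
have hEt a b :
    is_derive y0 (delta_mx 0 m) (fun y => (E (psi ch y))^T a b : R) ((dE m)^T a b).
  by under eq_fun do rewrite mxE; rewrite mxE; exact: hE.
have := is_derive_mulmx (is_derive_mulmx hE hT) hEt i j.
by rewrite psi0 mulmxDl.
Qed.

(** Identifies the derivative of the scalar function with the gradient term of the matrix
    inequality. Only diagonal entries of the differentiated frame matrix matter, and these are
    covariant by [covariant_diag_entry]. *)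
Lemma frame_d_sigma_quot (k : nat) (lam : 'rV[R]_n) (i : 'I_n) :
  frame_comp W ch E x = diag_mx lam -> (forall j, 0 < lam 0 j) ->
  frame_d ch E i (fun p => sigma_quot k (endo g W ch p)) x =
  \sum_a mx_d (sigma_quot k) a a (diag_mx lam) * frame_nabla g W ch E x i a a.
Proof.
move=> Wlam lam0.
have psi0 : psi ch y0 = x by apply: phiK; exact: Odom.
have diff0 : differentiable (sigma_quot k : 'M[R]_n -> R)
    (frame_comp W ch E (psi ch y0)).
  rewrite psi0 Wlam; apply: differentiable_sigma_quot.
  by rewrite sigma_mx_diag ?leq_subr // gt_eqF // weight_sum_gt0 // leq_subr.
have dg m : dE m *m gx *m Ex^T + Ex *m dT g m *m Ex^T + Ex *m gx *m (dE m)^T = 0.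
  apply/matrixP => a b; have [_ <-] := dframe g m a b.
  rewrite mxE (_ : 0 = 'D_(delta_mx 0 m) (cst ((1%:M : 'M[R]_n) a b)) y0); last first.
    by rewrite derive_cst.
  apply: near_eq_derive; near=> y; rewrite /= /frame_comp frame_orth //.
  by near: y; exact: near_psi_frame.
have step m : coord_d ch m (fun p => sigma_quot k (endo g W ch p)) x =
    \sum_a mx_d (sigma_quot k) a a (diag_mx lam) * (Ex *m N m *m Ex^T) a a.
  rewrite /coord_d /pderiv -/y0.
  transitivity ('D_(delta_mx 0 m)
      ((sigma_quot k : 'M[R]_n -> R) \o (fun y => frame_comp W ch E (psi ch y))) y0).
    apply: near_eq_derive; near=> y; rewrite /= sigma_quot_endo //.
    by near: y; exact: near_psi_frame.
  rewrite (@is_derive_matrix_comp _ _ _ _ (fun y => frame_comp W ch E (psi ch y))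
    _ _ _ diff0 (dframe W m)) psi0 Wlam.
  apply: eq_bigr => a _.
  (* At a diagonal matrix the off-diagonal first derivatives of the quotient vanish. *)
  rewrite (bigD1 a) //= big1 ?addr0 => [|b ba]; last first.
    have [-> _] := mx_d_sigma_quot k lam0 a a a b.
    by rewrite eq_sym (negPf ba) mul0r mulr0.
  rewrite mulrC NE; congr (_ * _).
  apply: (@covariant_diag_entry _ _ _ gx _ _ (dT g m) _ _ lam) => //.
  - exact: frame_orth.
  - by apply: Wsym; exact: Odom.
  - exact: metric_compat.
rewrite /frame_d.
under eq_bigr do rewrite step mulr_sumr.
rewrite exchange_big /=; apply: eq_bigr => a _.
rewrite frame_nablaE mulr_sumr; apply: eq_bigr => m _; exact: mulrCA.
Unshelve. all: by end_near. Qed.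

End SymmetricTensor.
End OrthonormalFrame.

(** * The matrix inequality and its tensor form *)

Theorem theorem1p1 (R : realType) (n k : nat) (hn : (2 <= n)%N)
    (hk : (1 <= k <= n - 1)%N) (delta : R) (hdelta : 0 < delta <= 1) :
  let one := idx1 hn in
  let F : 'M[R]_n -> R := sigma_quot k in
  exists2 eps0 : R, 0 < eps0 &
  (forall lam : 'rV[R]_n,
     let W := diag_mx lam in
     in_Gamma W ->
     (forall i j : 'I_n, (i <= j)%N -> lam 0 j <= lam 0 i) ->
     (forall i : 'I_n, 0 < lam 0 i) ->
     forall xi : 'M[R]_n, xi^T = xi ->
       - (\sum_(a < n) \sum_(b < n) \sum_(c < n) \sum_(d < n)
            mx_d2 F a b c d W * xi a b * xi c d)
       >= (1 + eps0) * mx_d F one one W * (xi one one ^+ 2 / lam 0 one)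
          + (1 - delta) * (\sum_(a < n | a != one)
              mx_d F a a W * (xi a a ^+ 2 / lam 0 a))
          - (\sum_(a < n) mx_d F a a W * xi a a) ^+ 2 / F W
          + \sum_(a < n | a != one) \sum_(c < n | (c != one) && (a != c))
              mx_d F a a W * (xi a c ^+ 2 / lam 0 c)
          + (1 + (n%:R - k%:R) / (n%:R - 1)) * (\sum_(a < n | a != one)
              mx_d F a a W * (xi a one ^+ 2 / lam 0 one)))
  /\
  (forall (M : smoothManifold R n) (g W : tensor02 M),
     riemannian_metric g -> symmetric_tensor W ->
     (forall (ch : chart M) (p : M), dom ch p -> in_Gamma (endo g W ch p)) ->
     forall (x : M) (ch : chart M) (O : set M) (E : M -> 'M[R]_n),
       orthonormal_frame g ch O E -> O x ->
     forall lam : 'rV[R]_n,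
       frame_comp W ch E x = diag_mx lam ->
       (forall i j : 'I_n, (i <= j)%N -> lam 0 j <= lam 0 i) ->
       (forall i : 'I_n, 0 < lam 0 i) ->
     forall i : 'I_n,
       let Wx := frame_comp W ch E x in
       let w (a b : 'I_n) := frame_nabla g W ch E x i a b in
       - (\sum_(a < n) \sum_(b < n) \sum_(c < n) \sum_(d < n)
            mx_d2 F a b c d Wx * w a b * w c d)
       >= (1 + eps0) * mx_d F one one Wx * (w one one ^+ 2 / lam 0 one)
          + (1 - delta) * (\sum_(a < n | a != one)
              mx_d F a a Wx * (w a a ^+ 2 / lam 0 a))
          - frame_d ch E i (fun p => F (endo g W ch p)) x ^+ 2 / F Wx).
Proof.
(* The constant is the one produced by [complement_sum_variance]. *)
move=> one F; exists (delta / (4 * n%:R)).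
  case/andP: hdelta => delta0 _; rewrite divr_gt0 // mulr_gt0 // ltr0n.
  exact: ltnW hn.
split=> [lam W _ lam_mono lam_gt0 xi xiT|].
  by apply: diag_hessian_ineq => // i; exact: lam_mono.
move=> M g W gR Wsym _ x ch O E onE Ox lam Wlam lam_mono lam_gt0 i.
cbv zeta; rewrite Wlam.
have lam_max j : lam 0 j <= lam 0 one by exact: lam_mono.
pose xi : 'M[R]_n := \matrix_(a, b) frame_nabla g W ch E x i a b.
(* The covariant derivative of a symmetric tensor is symmetric in its last two slots, so it is an
   admissible [xi]. *)
have xiT : xi^T = xi.
  by apply/matrixP => a b; rewrite !mxE; exact: (frame_nabla_sym onE Ox Wsym).
have xiE : frame_nabla g W ch E x i = (fun a b => xi a b).
  by apply: funext => a; apply: funext => b; rewrite mxE.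
rewrite (frame_d_sigma_quot gR onE Ox Wsym k i Wlam lam_gt0) xiE.
have F0 : 0 <= F (diag_mx lam) := ltW (sigma_quot_diag_gt0 k lam_gt0).
have Fa0 a : 0 <= mx_d F a a (diag_mx lam).
  rewrite mx_d_diag //; apply: divr_ge0; last exact: ltW.
  by apply: mulr_ge0 => //; apply: avg_ge0 => [||T _] //; rewrite ?leq_subr ?ler0n.
have term0 a b c : 0 <= mx_d F a a (diag_mx lam) * (xi a b ^+ 2 / lam 0 c).
  by rewrite mulr_ge0 // divr_ge0 ?sqr_ge0 // ltW.
have H := diag_hessian_ineq hk hdelta lam_max lam_gt0 xiT.
(* The tensor inequality follows by discarding the two off-diagonal sums, which are nonnegative. *)
apply: le_trans H; rewrite -[leRHS]addrA lerDl addr_ge0 //.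
  by apply: sumr_ge0 => a _; apply: sumr_ge0 => c _.
rewrite mulr_ge0 ?sumr_ge0 // addr_ge0 // divr_ge0 // subr_ge0.
  by case/andP: hk => _ kn; rewrite ler_nat (leq_trans kn) // leq_subr.
by rewrite ler1n ltnW.
Qed.
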